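(* Let $k,\ell\ge 1$ be integers and let $(x_{ij})_{1\le i\le k,\,1\le j\le \ell}$ be a table of positive integers (a contingency table without empty cells). Put $R_i=\sum_j x_{ij}$, $S_j=\sum_i x_{ij}$, $N=\sum_{i,j}x_{ij}$, and write $\tau=2\pi$. Let $(X_{ij})$ be the random contingency table with row sums $R_i$ and column sums $S_j$ distributed according to the null hypothesis of independence conditioned on the margins, and let $I$ be the empirical mutual information (in nats) of the table $(x_{ij})$. Then $$\Pr\left(X_{ij}=x_{ij}\text{ for all }i,j\right)\leq \mathrm{e}^{-N\cdot I}\left(\frac{\prod_{i}R_{i}\prod_{j}S_{j}}{\tau^{(k-1)(\ell-1)}\,N\prod_{i,j}x_{ij}}\right)^{1/2}.$$
   Context: With fixed row sums $R_i$ and column sums $S_j$, the distribution of the random table under independence is given by $$\Pr\left(X_{ij}=x_{ij}\text{ for all }i,j\right)=\frac{\prod_i R_i!\,\prod_j S_j!}{N!\,\prod_{i,j}x_{ij}!}.$$ The empirical mutual information $I$ of the table $(x_{ij})$ is defined by $$N\cdot I=\sum_{i,j}x_{ij}\ln\frac{N x_{ij}}{R_iS_j}=\sum_{i,j}x_{ij}\ln x_{ij}-\sum_i R_i\ln R_i-\sum_j S_j\ln S_j+N\ln N .$$ *)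

(* Defs.v *)
From mathcomp Require Import all_boot all_order all_algebra.
From mathcomp Require Import all_classical all_reals all_analysis.

Set Implicit Arguments.
Unset Strict Implicit.
Unset Printing Implicit Defensive.

Import Order.TTheory GRing.Theory Num.Theory.

Local Open Scope ring_scope.

Section Tables.
Variables (k l : nat).
Implicit Type x : 'M[nat]_(k, l).

Definition row_sum x (i : 'I_k) : nat := (\sum_(j < l) x i j)%N.
Definition col_sum x (j : 'I_l) : nat := (\sum_(i < k) x i j)%N.
Definition grand_total x : nat := (\sum_(i < k) \sum_(j < l) x i j)%N.

Definition has_margins (r : 'I_k -> nat) (s : 'I_l -> nat) x : bool :=
  [forall i, row_sum x i == r i] && [forall j, col_sum x j == s j].

Definition mutual_info (R : realType) x : R :=
  (grand_total x)%:R^-1 *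
  \sum_(i < k) \sum_(j < l) (x i j)%:R *
    ln (((grand_total x)%:R * (x i j)%:R) / ((row_sum x i)%:R * (col_sum x j)%:R)).

(* Distribution of a contingency table under independence, conditioned on the
   row sums r and the column sums s; (grand_total x) is then the common sum of r
   and of s. *)
Definition indep_pmf (R : realType) (r : 'I_k -> nat) (s : 'I_l -> nat) x : R :=
  if has_margins r s x then
    ((\prod_(i < k) (r i)`!)%N%:R * (\prod_(j < l) (s j)`!)%N%:R) /
    ((grand_total x)`!%:R * (\prod_(i < k) \prod_(j < l) (x i j)`!)%N%:R)
  else 0.

End Tables.

Definition table_event (T : Type) (k l : nat) (X : 'I_k -> 'I_l -> T -> nat)
    (x : 'M[nat]_(k, l)) : set T :=
  [set t | forall i j, X i j t = x i j]%classic.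

Definition indep_table (d : measure_display) (T : measurableType d)
    (R : realType) (P : probability T R) (k l : nat)
    (r : 'I_k -> nat) (s : 'I_l -> nat)
    (X : 'I_k -> 'I_l -> {RV P >-> nat}) : Prop :=
  forall y : 'M[nat]_(k, l),
    P (table_event (fun i j => X i j : T -> nat) y) = (indep_pmf R r s y)%:E.

(* Main.v *)
Require Import Defs.
From mathcomp Require Import all_boot all_order all_algebra.
From mathcomp Require Import all_classical all_reals all_analysis.
From mathcomp Require Import ring lra.

Import Order.TTheory GRing.Theory Num.Theory.

Local Open Scope ring_scope.

(** Write n! = sqrt (2 pi n) (n / e)^n exp (u n).  Taking logarithms, the powers
    and square roots account exactly for the right-hand side, and what remains is
    sum_i u (R_i) + sum_j u (S_j) <= u N + sum_(i,j) u (x_ij).  This only uses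
    that u is nonnegative and nonincreasing: if k, l >= 2, each margin can be
    charged to a cell of its own line, with distinct cells for distinct margins;
    if k = 1 or l = 1, equality holds.  That u >= 0 comes from Wallis' estimate,
    which says u (2 n) <= 2 u n, together with the crude bound
    n! >= (n / e)^n. *)

Lemma is_derive_ge0_le (R : realType) (f df : R -> R) (a b : R) : a <= b ->
  (forall x, a <= x <= b -> is_derive x 1 f (df x)) ->
  (forall x, a <= x <= b -> 0 <= df x) -> f a <= f b.
Proof.
move=> ab fdf df0.
have [x||c cab] := @MVT_segment R f df a b ab.
- by rewrite in_itv /= => /andP[ax xb]; apply: fdf; rewrite !ltW.
- apply: derivable_within_continuous => x; rewrite in_itv /= => xab.
  by apply: ex_derive; exact: fdf.
move=> fE; rewrite -subr_ge0 fE mulr_ge0 ?subr_ge0 //.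
by apply: df0; move: cab; rewrite in_itv.
Qed.

(** * Wallis integrals and the central binomial coefficient *)

Section Wallis.
Context {R : realType}.
Implicit Types (x : R) (n : nat).

(* The reduction formula of the Wallis integrals, read as a definition of
   primitives of the powers of sin. *)
Fixpoint sin_prim n x : R :=
  match n with
  | 0 => x
  | n'.+1 => match n' with
    | 0 => - cos x
    | m.+1 => (n'%:R * sin_prim m x - cos x * sin x ^+ n') / n%:R
    end
  end.

Lemma is_derive_sin_prim n x : is_derive x 1 (sin_prim n) (sin x ^+ n).
Proof.
have [m] := ubnP n; elim: m n => // m IH [|[|n]] nm.
- by rewrite expr0; exact: is_derive_id.
- have := is_deriveN (is_derive_cos x); rewrite opprK expr1; exact.
have IHn : is_derive x 1 (sin_prim n) (sin x ^+ n).
  by apply: IH; rewrite ltnS in nm; exact: leq_trans nm.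
(* Written as a combination of functions, so that its derivative is found by instance resolution. *)
have -> : sin_prim n.+2 =
    n.+2%:R^-1 *: (n.+1%:R *: sin_prim n - cos * (sin ^+ n.+1)).
  by apply/funext => y; rewrite !fctE /= -[_ *: _]/(_ * _) mulrC;
    congr (_ * _ ); rewrite -[_ *: _]/(_ * _).
apply: is_derive_eq.
rewrite -![_ *: _]/(_ * _).
have n2 : n.+2%:R != 0 :> R by rewrite pnatr_eq0.
apply: (mulfI n2); rewrite !fctE.
rewrite mulVKf //=.
have -> : n.+2%:R = n.+1%:R + 1 :> R by rewrite natr1.
transitivity (n.+1%:R * sin x ^+ n * (1 - cos x ^+ 2) + sin x ^+ n.+2 : R).
  by rewrite !exprS; ring.
have -> : 1 - cos x ^+ 2 = sin x ^+ 2 by rewrite -(cos2Dsin2 x) addrAC subrr add0r.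
by rewrite !exprS; ring.
Qed.

(** The integral of [sin x ^+ n] over [0, pi/2], expressed by a primitive so that only derivatives
    occur. *)
Definition wallis n : R := sin_prim n (pi / 2) - sin_prim n 0.

Lemma wallis0 : wallis 0 = pi / 2.
Proof. by rewrite /wallis /= subr0. Qed.

Lemma wallis1 : wallis 1 = 1.
Proof. by rewrite /wallis /= cos_pihalf cos0 opprK oppr0 add0r. Qed.

Lemma wallisSS n : n.+2%:R * wallis n.+2 = n.+1%:R * wallis n.
Proof.
have n2 : n.+2%:R != 0 :> R by rewrite pnatr_eq0.
by rewrite /wallis /= cos_pihalf sin0 expr0n /=; field.
Qed.

Lemma wallis_gt0 n : 0 < wallis n.
Proof.
have [m] := ubnP n; elim: m n => // m IH [|[|n]] nm.
- by rewrite wallis0 divr_gt0 ?pi_gt0.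
- by rewrite wallis1.
have := mulr_gt0 (ltr0Sn R n) (IH n (ltnW nm)).
by rewrite -wallisSS pmulr_rgt0 ?ltr0Sn.
Qed.

(** The difference of the two primitives has derivative sin^n (1 - sin) >= 0 on [0, pi/2]. *)
Lemma wallis_nincr n : wallis n.+1 <= wallis n.
Proof.
rewrite -subr_ge0.
have -> : wallis n - wallis n.+1 =
    (sin_prim n - sin_prim n.+1) (pi / 2) - (sin_prim n - sin_prim n.+1) 0.
  by rewrite !fctE /wallis; ring.
rewrite subr_ge0.
apply: (@is_derive_ge0_le R _ (fun x => sin x ^+ n - sin x ^+ n.+1)).
- by rewrite divr_ge0 // ltW // pi_gt0.
- by move=> x _; apply: is_deriveB; exact: is_derive_sin_prim.
move=> x /andP[x0 xpi].
have s0 : 0 <= sin x.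
  by apply: sin_ge0_pi; rewrite x0 /=; have := pi_gt0 R; lra.
by rewrite exprS -{1}[_ ^+ n]mul1r -mulrBl mulr_ge0 ?exprn_ge0 // subr_ge0 sin_le1.
Qed.

(** By [wallisSS] the left-hand side does not depend on n. *)
Lemma wallis_mul n : n.+1%:R * (wallis n * wallis n.+1) = pi / 2.
Proof.
elim: n => [|n IH]; first by rewrite wallis0 wallis1 !mulr1 mul1r.
by rewrite mulrCA wallisSS mulrCA [wallis n.+1 * _]mulrC.
Qed.

Lemma wallis_double n :
  wallis n.*2 * (4 ^+ n * n`!%:R ^+ 2) = pi / 2 * (n.*2)`!%:R.
Proof.
elim: n => [|n IH]; first by rewrite wallis0 !fact0 expr0 !expr1n !mulr1.
have n2 : n.*2.+2%:R != 0 :> R by rewrite pnatr_eq0.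
apply: (mulfI n2); rewrite doubleS [LHS]mulrA wallisSS !factS !natrM exprS.
transitivity (n.*2.+1%:R * (4 * n.+1%:R ^+ 2) * (pi / 2 * (n.*2)`!%:R) : R).
  by rewrite -IH; ring.
have -> : n.*2.+2%:R = 2 * n.+1%:R :> R by rewrite -doubleS -mul2n natrM.
by ring.
Qed.

(** From W_(2n)^2 <= W_(2n-1) W_(2n) = pi / (4n) and [wallis_double], with W for [wallis]; this is
    the bound binom(2n, n) <= 4^n / sqrt (pi n). *)
Lemma central_bin_le n : (0 < n)%N ->
  (n.*2)`!%:R ^+ 2 * (pi * n%:R) <= 16 ^+ n * n`!%:R ^+ 4 :> R.
Proof.
case: n => // n _; have p0 := pi_gt0 R.
set F := (n.+1.*2)`!%:R; set G := n.+1`!%:R.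
have W2 : wallis n.+1.*2 ^+ 2 * n.+1.*2%:R <= pi / 2 :> R.
  rewrite -(wallis_mul n.*2.+1) doubleS mulrC ler_pM2l ?ltr0Sn // expr2.
  by rewrite ler_pM2r ?wallis_gt0 // wallis_nincr.
have WE : wallis n.+1.*2 * (4 ^+ n.+1 * G ^+ 2) = pi / 2 * F := wallis_double n.+1.
have N2 : n.+1.*2%:R = 2 * n.+1%:R :> R by rewrite -mul2n natrM.
have -> : 16 ^+ n.+1 * G ^+ 4 = (4 ^+ n.+1 * G ^+ 2) ^+ 2.
  have -> : 16 = 4 ^+ 2 :> R by rewrite -natrX.
  by rewrite [RHS]exprMn exprAC -[_ ^+ 2 ^+ 2 in RHS]exprM.
set H := 4 ^+ n.+1 * G ^+ 2 in WE *.
have p2 : 0 < pi / 2 :> R by rewrite divr_gt0.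
rewrite -(ler_pM2l p2).
have -> : pi / 2 * (F ^+ 2 * (pi * n.+1%:R)) = (pi / 2 * F) ^+ 2 * (2 * n.+1%:R) by field.
by rewrite -WE exprMn -N2 mulrAC ler_wpM2r // sqr_ge0.
Qed.

End Wallis.

(** The difference of the two sides vanishes at 1 and has derivative ln t + 1/t - 1 >= 0. At y =
    (n+1)/n this yields the monotonicity of [stirling_rem]. *)
Lemma le_ln_pade (R : realType) (y : R) : 1 <= y -> 2 * (y - 1) <= (y + 1) * ln y.
Proof.
move=> y1; rewrite -subr_ge0.
pose f : R -> R := ((id : R -> R) + cst 1) * (@ln R) - cst 2 * ((id : R -> R) - cst 1).
rewrite -[leRHS]/(f y).
have <- : f 1 = 0.
  by rewrite /f !fctE ln1 mulr0 subrr mulr0 subrr.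
apply: (@is_derive_ge0_le R f (fun t => ln t + t^-1 - 1)) => // t /andP[t1 _].
  have t0 : 0 < t by rewrite (lt_le_trans ltr01).
  have dln := is_derive1_ln t0.
  apply: is_derive_eq.
  rewrite !fctE -![_ *: _]/(_ * _).
  by field; rewrite gt_eqF.
have t0 : 0 < t by rewrite (lt_le_trans ltr01).
have := @le_ln1Dx R (t^-1 - 1).
have -> : 1 + (t^-1 - 1) = t^-1 by ring.
rewrite lnV ?posrE // => h.
have : -1 < t^-1 - 1 by rewrite ltrBDr addNr invr_gt0.
by move/h; lra.
Qed.

(** * Stirling's formula: the remainder is nonincreasing and nonnegative *)

Section Stirling.
Context {R : realType}.
Implicit Types n : nat.

(* The Binet remainder: n! = sqrt (2 pi n) (n / e)^n exp (stirling_rem n). *)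
Definition stirling_rem n : R :=
  ln n`!%:R - (n%:R + 2^-1) * ln n%:R + n%:R - ln (2 * pi) / 2.

(** One step lowers the remainder by (n + 1/2) ln ((n+1)/n) - 1, which [le_ln_pade] shows to be
    nonnegative. *)
Lemma stirling_rem_nincrS n : (0 < n)%N -> stirling_rem n.+1 <= stirling_rem n.
Proof.
move=> n0; have N0 : 0 < n%:R :> R by rewrite ltr0n.
have := @le_ln_pade R (n.+1%:R / n%:R).
rewrite ler_pdivlMr // mul1r ler_nat leqnSn => /(_ isT).
rewrite ln_div ?posrE ?ltr0Sn //.
rewrite /stirling_rem factS natrM lnM ?posrE ?ltr0Sn ?ltr0n ?fact_gt0 //.
rewrite -[n.+1%:R]natr1 => h.
suff : 1 <= (n%:R + 2^-1) * (ln (n%:R + 1) - ln n%:R) :> R by lra.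
have : n%:R * (2 * ((n%:R + 1) / n%:R - 1)) <=
    n%:R * (((n%:R + 1) / n%:R + 1) * (ln (n%:R + 1) - ln n%:R)) :> R.
  by rewrite ler_pM2l.
have -> : n%:R * (2 * ((n%:R + 1) / n%:R - 1)) = 2 :> R by field; rewrite gt_eqF.
have -> : n%:R * (((n%:R + 1) / n%:R + 1) * (ln (n%:R + 1) - ln n%:R)) =
    2 * ((n%:R + 2^-1) * (ln (n%:R + 1) - ln n%:R)) :> R by field; rewrite gt_eqF.
by lra.
Qed.

Lemma stirling_rem_nincr m n : (0 < m <= n)%N -> stirling_rem n <= stirling_rem m.
Proof.
move=> /andP[m0 /subnK <-]; elim: (n - m)%N => // p IH.
by rewrite addSn (le_trans _ IH) // stirling_rem_nincrS // addn_gt0 m0 orbT.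
Qed.

(** Half the logarithm of [central_bin_le]; the pi there matches the constant ln (2 pi) / 2 of the
    remainder. *)
Lemma stirling_rem_double n : (0 < n)%N -> stirling_rem n.*2 <= 2 * stirling_rem n.
Proof.
move=> n0; have N0 : 0 < n%:R :> R by rewrite ltr0n.
have p0 := pi_gt0 R.
have F0 m : 0 < m`!%:R :> R by rewrite ltr0n fact_gt0.
have := @central_bin_le R n n0.
rewrite -ler_ln ?posrE ?mulr_gt0 ?exprn_gt0 //.
rewrite !lnM ?posrE ?mulr_gt0 ?exprn_gt0 // !lnXn //.
have -> : ln 16 = 4 * ln 2 :> R.
  by rewrite (_ : 16 = 2 ^+ 4 :> R) ?lnXn ?mulr_natl // -natrX.
rewrite -[(4 * ln 2) *+ n]mulr_natl.
rewrite /stirling_rem -mul2n natrM !lnM ?posrE //.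
by lra.
Qed.

(** Equivalent to n! >= (n/e)^n, which comes from a single term of the exponential series at n. *)
Lemma stirling_rem_ge n : (0 < n)%N ->
  - (ln n%:R / 2) - ln (2 * pi) / 2 <= stirling_rem n.
Proof.
case: n => // n _; set m := n.+1.
have M0 : 0 < m%:R :> R by rewrite ltr0Sn.
have F0 : 0 < m`!%:R :> R by rewrite ltr0n fact_gt0.
have : m%:R ^+ m / m`!%:R <= expR m%:R :> R.
  by rewrite (le_trans _ (expR_ge1Dxn n (ltW M0))) // ler_wpDl.
rewrite -ler_ln ?posrE ?divr_gt0 ?exprn_gt0 ?expR_gt0 //.
rewrite expRK ln_div ?posrE ?exprn_gt0 // lnXn // /stirling_rem -mulr_natl.
by lra.
Qed.

(* Doubling a negative remainder would make it tend to -oo geometrically,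
   whereas it is bounded below by a logarithm. *)
Lemma stirling_rem_ge0 n : (0 < n)%N -> 0 <= stirling_rem n.
Proof.
move=> n0; rewrite leNgt; apply/negP => u0.
have N0 : 0 < n%:R :> R by rewrite ltr0n.
(* Two doublings at a time: the factor 4^m is at least m^2 and so outgrows the lower bound, which is
   linear in m. With 2^m the estimate m <= 2^m would not suffice. *)
have iter m : stirling_rem (4 ^ m * n) <= (4 ^ m)%:R * stirling_rem n.
  elim: m => [|m IH]; first by rewrite expn0 mul1n mul1r.
  have -> : (4 ^ m.+1 * n = (4 ^ m * n).*2.*2)%N by rewrite -!mul2n expnS !mulnA.
  have p : (0 < 4 ^ m * n)%N by rewrite muln_gt0 expn_gt0.
  have := stirling_rem_double _ p.
  have p2 : (0 < (4 ^ m * n).*2)%N by rewrite double_gt0.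
  have := stirling_rem_double _ p2.
  by rewrite expnS natrM; lra.
(* Chosen so that m K bounds m ln 4 / 2 + ln n / 2 + ln (2 pi) / 2 for m >= 1; the absolute value
   also helps to make K >= 0, as [archi_boundP] requires. *)
pose K : R := ln 4 / 2 + `|ln n%:R / 2 + ln (2 * pi) / 2|.
have bnd m : (0 < m)%N -> m%:R * (- stirling_rem n) <= K.
  move=> m0; have M1 : 1 <= m%:R :> R by rewrite ler1n.
  have M0 : 0 < m%:R :> R by rewrite ltr0n.
  have p : (0 < 4 ^ m * n)%N by rewrite muln_gt0 expn_gt0.
  have := le_trans (stirling_rem_ge _ p) (iter m).
  rewrite natrM lnM ?posrE ?ltr0n ?expn_gt0 // natrX lnXn // -[ln 4 *+ m]mulr_natl.
  have m4 : m%:R ^+ 2 <= 4 ^+ m :> R.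
    rewrite -!natrX ler_nat -[4%N]/(2 ^ 2)%N -expnM mulnC expnM leq_exp2r //.
    by rewrite ltnW // ltn_expl.
  have := ler_wpM2r (ltW (_ : 0 < - stirling_rem n)) m4.
  rewrite oppr_gt0 => /(_ u0) h1 h2.
  rewrite -(ler_pM2l M0).
  have := ler_norm (ln n%:R / 2 + ln (2 * pi) / 2 : R).
  have := normr_ge0 (ln n%:R / 2 + ln (2 * pi) / 2 : R).
  rewrite /K; set q := `| _ | => q0 qle.
  have : q <= m%:R * q by rewrite ler_peMl.
  by lra.
have K0 : 0 <= K / - stirling_rem n.
  by rewrite divr_ge0 ?addr_ge0 ?divr_ge0 ?ln_ge0 ?ler1n // oppr_ge0 ltW.
have := bnd (Num.bound (K / - stirling_rem n)).+1 isT.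
rewrite -ler_pdivlMr ?oppr_gt0 // leNgt => /negP; apply.
by rewrite (lt_trans (archi_boundP K0)) // ltr_nat.
Qed.

End Stirling.

(** * Logarithms of products and of factorials *)

Lemma ln_prod (R : realType) (I : finType) (f : I -> R) : (forall i, 0 < f i) ->
  ln (\prod_i f i) = \sum_i ln (f i).
Proof.
(* Positivity is carried through the induction, since [lnM] needs positive factors. *)
move=> f0; suff [] : 0 < \prod_i f i /\ ln (\prod_i f i) = \sum_i ln (f i) by [].
apply: (big_ind2 (fun a b => 0 < a /\ ln a = b)); first by rewrite ln1.
- by move=> a b c d [a0 <-] [c0 <-]; rewrite mulr_gt0 // lnM.
- by move=> i _; rewrite f0.
Qed.

(** Applied alike to rows, columns, cells and total: the linear terms then all become N and cancel,
    and the cardinals give the power of [tau]. *)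
Lemma sum_ln_fact (R : realType) (I : finType) (f : I -> nat) :
  \sum_i ln (f i)`!%:R = \sum_i stirling_rem (f i) + \sum_i (f i)%:R * ln (f i)%:R
    + (\sum_i ln (f i)%:R) / 2 - (\sum_i f i)%N%:R + #|I|%:R * (ln (2 * pi) / 2) :> R.
Proof.
rewrite natr_sum mulr_natl -sumr_const mulr_suml -sumrN -!big_split /=.
by apply: eq_bigr => i _; rewrite /stirling_rem; ring.
Qed.

(** * Charging margins to cells *)

Lemma sum_margins_le (R : realType) (f : nat -> R) (k l : nat) (x : 'M[nat]_(k, l)) :
  (0 < k)%N -> (0 < l)%N -> (forall i j, (0 < x i j)%N) ->
  (forall n, (0 < n)%N -> 0 <= f n) ->
  (forall m n, (0 < m <= n)%N -> f n <= f m) ->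
  \sum_i f (row_sum x i) + \sum_j f (col_sum x j) <=
  f (grand_total x) + \sum_i \sum_j f (x i j).
Proof.
move=> + + hx f0 fle.
have rowle i j : f (row_sum x i) <= f (x i j).
  by apply: fle; rewrite hx /row_sum (bigD1 j) //= leq_addr.
have colle i j : f (col_sum x j) <= f (x i j).
  by apply: fle; rewrite hx /col_sum (bigD1 i) //= leq_addr.
case: k x hx rowle colle => // -[|k] x hx rowle colle _.
  (* A single row: its sum is the total, and each column sum is a cell. *)
  move=> _; rewrite /grand_total !big_ord1 /row_sum.
  by rewrite lerD2l ler_sum // => j _; rewrite /col_sum big_ord1.
case: l x hx rowle colle => // -[|l] x hx rowle colle _.
  rewrite /grand_total exchange_big /= big_ord1 /col_sum big_ord1 addrC lerD2l.
  by rewrite ler_sum // => j _; rewrite /row_sum !big_ord1.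
have N0 : 0 <= f (grand_total x).
  by apply: f0; rewrite /grand_total big_ord_recl big_ord_recl addn_gt0 addn_gt0 hx.
(* Row 0 is charged to (0,1), row i > 0 to (i,0), column 0 to (0,0), column 1 to (1,1)
   and column j > 1 to (0,j). *)
have x0 i j : 0 <= f (x i j) by rewrite f0.
have rest0 i : 0 <= \sum_(j < l.+1) f (x i (lift ord0 j)) by rewrite sumr_ge0.
rewrite (big_ord_recl k.+1 (fun i => f (row_sum x i))).
rewrite (big_ord_recl l.+1 (fun i => f (col_sum x i))).
rewrite (big_ord_recl l (fun i => f (col_sum x (lift ord0 i)))).
have colrest : \sum_(j < l) f (col_sum x (lift ord0 (lift ord0 j))) <=
    \sum_(j < l) f (x ord0 (lift ord0 (lift ord0 j))).
  by apply: ler_sum.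
(* Column 1 is charged to a cell of row 1, hence bounded together with the rows below row 0. *)
have rowrest : \sum_(i < k.+1) f (row_sum x (lift ord0 i)) + f (col_sum x (lift ord0 ord0))
    <= \sum_(i < k.+1) \sum_(j < l.+2) f (x (lift ord0 i) j).
  rewrite !big_ord_recl.
  have : \sum_(i < k) f (row_sum x (lift ord0 (lift ord0 i))) <=
      \sum_(i < k) \sum_(j < l.+2) f (x (lift ord0 (lift ord0 i)) j).
    apply: ler_sum => i _; rewrite big_ord_recl.
    by rewrite (le_trans (rowle _ ord0)) // lerDl.
  have := rowle (lift ord0 ord0) ord0.
  have := colle (lift ord0 ord0) (lift ord0 ord0).
  have : 0 <= \sum_(i < l) f (x (lift ord0 ord0) (lift ord0 (lift ord0 i))).
    by rewrite sumr_ge0.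
  by lra.
rewrite (big_ord_recl k.+1 (fun i => \sum_j f (x i j))).
rewrite (big_ord_recl l.+1 (fun j => f (x ord0 j))).
rewrite (big_ord_recl l (fun j => f (x ord0 (lift ord0 j)))).
have := rowle ord0 (lift ord0 ord0).
have := colle ord0 ord0.
by lra.
Qed.

(** * Positive margins and the mutual information *)

Section Positive_margins.
Context {k l : nat} (x : 'M[nat]_(k, l)) (hx : forall i j, (0 < x i j)%N).

Lemma row_sum_gt0 i : (0 < l)%N -> (0 < row_sum x i)%N.
Proof.
by move=> l0; rewrite /row_sum (bigD1 (Ordinal l0)) //= addn_gt0 hx.
Qed.

Lemma col_sum_gt0 j : (0 < k)%N -> (0 < col_sum x j)%N.
Proof.
by move=> k0; rewrite /col_sum (bigD1 (Ordinal k0)) //= addn_gt0 hx.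
Qed.

Lemma grand_total_gt0 : (0 < k)%N -> (0 < l)%N -> (0 < grand_total x)%N.
Proof.
move=> k0 l0; rewrite /grand_total (bigD1 (Ordinal k0)) //= addn_gt0.
by have /= -> := row_sum_gt0 (Ordinal k0) l0.
Qed.

End Positive_margins.

(** Expanding the outer factor of each margin term over its cells reduces the identity to the
    logarithm of one quotient per cell. Cells are indexed by pairs to match [sum_ln_fact]. *)
Lemma mutual_infoE (R : realType) (k l : nat) (x : 'M[nat]_(k, l)) :
  (0 < k)%N -> (0 < l)%N -> (forall i j, (0 < x i j)%N) ->
  (grand_total x)%:R * mutual_info R x =
  \sum_(p : 'I_k * 'I_l) (x p.1 p.2)%:R * ln (x p.1 p.2)%:R
  - \sum_i (row_sum x i)%:R * ln (row_sum x i)%:R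
  - \sum_j (col_sum x j)%:R * ln (col_sum x j)%:R
  + (grand_total x)%:R * ln (grand_total x)%:R.
Proof.
move=> k0 l0 hx.
have N0 : 0 < (grand_total x)%:R :> R by rewrite ltr0n grand_total_gt0.
rewrite /mutual_info mulVKf ?gt_eqF //.
have -> : \sum_(p : 'I_k * 'I_l) (x p.1 p.2)%:R * ln (x p.1 p.2)%:R =
    \sum_i \sum_j (x i j)%:R * ln (x i j)%:R :> R by rewrite pair_bigA.
have -> : \sum_i (row_sum x i)%:R * ln (row_sum x i)%:R =
    \sum_i \sum_j (x i j)%:R * ln (row_sum x i)%:R :> R.
  by apply: eq_bigr => i _; rewrite {1}/row_sum natr_sum mulr_suml.
have -> : \sum_j (col_sum x j)%:R * ln (col_sum x j)%:R =
    \sum_i \sum_j (x i j)%:R * ln (col_sum x j)%:R :> R.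
  by rewrite exchange_big; apply: eq_bigr => j _; rewrite {1}/col_sum natr_sum mulr_suml.
have -> : (grand_total x)%:R * ln (grand_total x)%:R =
    \sum_i \sum_j (x i j)%:R * ln (grand_total x)%:R :> R.
  rewrite {1}/grand_total natr_sum mulr_suml.
  by apply: eq_bigr => i _; rewrite natr_sum mulr_suml.
rewrite -!sumrB -big_split; apply: eq_bigr => i _ /=.
rewrite -!sumrB -big_split; apply: eq_bigr => j _ /=.
have x0 : 0 < (x i j)%:R :> R by rewrite ltr0n.
have r0 : 0 < (row_sum x i)%:R :> R by rewrite ltr0n row_sum_gt0.
have s0 : 0 < (col_sum x j)%:R :> R by rewrite ltr0n col_sum_gt0.
by rewrite ln_div ?posrE ?mulr_gt0 // !lnM ?posrE //; ring.
Qed.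

(** * Comparison of the logarithms of both sides *)

Theorem theorem1 (R : realType) (k l : nat) (hk : (1 <= k)%N) (hl : (1 <= l)%N)
    (x : 'M[nat]_(k, l)) (hx : forall i j, (0 < x i j)%N)
    (d : measure_display) (T : measurableType d) (P : probability T R)
    (X : 'I_k -> 'I_l -> {RV P >-> nat})
    (hX : indep_table (row_sum x) (col_sum x) X) :
  let N : R := (grand_total x)%:R in
  let tau : R := 2 * pi in
  (P (table_event (fun i j => X i j : T -> nat) x) <=
    (expR (- (N * mutual_info R x)) *
     Num.sqrt
       (((\prod_(i < k) (row_sum x i)%:R) * (\prod_(j < l) (col_sum x j)%:R)) /
        (tau ^+ ((k - 1) * (l - 1)) * N *
         \prod_(i < k) \prod_(j < l) (x i j)%:R)))%:E)%E.
Proof.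
lazy zeta; set N : R := (grand_total x)%:R; set tau : R := 2 * pi.
rewrite hX lee_fin /indep_pmf.
have -> : has_margins (row_sum x) (col_sum x) x.
  by apply/andP; split; apply/forallP.
have N0 : 0 < N by rewrite ltr0n grand_total_gt0.
have tau0 : 0 < tau by rewrite mulr_gt0 ?pi_gt0.
have r0 i : 0 < (row_sum x i)%:R :> R by rewrite ltr0n row_sum_gt0.
have s0 j : 0 < (col_sum x j)%:R :> R by rewrite ltr0n col_sum_gt0.
have x0 p : 0 < (x p.1 p.2)%:R :> R by rewrite ltr0n.
have fact0 n : 0 < n`!%:R :> R by rewrite ltr0n fact_gt0.
have rem_le := @sum_margins_le R stirling_rem k l x hk hl hx
  stirling_rem_ge0 stirling_rem_nincr.
have NIE := @mutual_infoE R k l x hk hl hx.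
have rowE := @sum_ln_fact R 'I_k (row_sum x).
have colE := @sum_ln_fact R 'I_l (col_sum x).
have cellE := @sum_ln_fact R ('I_k * 'I_l)%type (fun p => x p.1 p.2).
(* The total is taken as a family with one member, to reuse the same expansion. *)
have totE := @sum_ln_fact R 'I_1 (fun=> grand_total x).
have xN : (\sum_(p : 'I_k * 'I_l) x p.1 p.2 = grand_total x)%N.
  by rewrite /grand_total pair_bigA.
have rN : (\sum_i row_sum x i = grand_total x)%N by [].
have sN : (\sum_j col_sum x j = grand_total x)%N by rewrite /grand_total exchange_big.
rewrite !big_ord1 card_ord in totE.
rewrite card_ord rN in rowE; rewrite card_ord sN in colE.
rewrite card_prod !card_ord xN in cellE.
rewrite pair_bigA /= in rem_le.
rewrite !pair_bigA !natr_prod /=.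
set A := _ / (_ * _ * _).
have A0 : 0 < A by rewrite /A divr_gt0 ?mulr_gt0 ?prodr_gt0 ?exprn_gt0.
have lnA : ln (Num.sqrt A) = ln A / 2.
  have {2}-> : A = Num.sqrt A ^+ 2 by rewrite sqr_sqrtr // ltW.
  by rewrite lnXn ?sqrtr_gt0 // -[_ *+ 2]mulr_natr mulfK.
rewrite -ler_ln ?posrE ?divr_gt0 ?mulr_gt0 ?prodr_gt0 ?expR_gt0 ?sqrtr_gt0 //.
rewrite [leRHS]lnM ?posrE ?expR_gt0 ?sqrtr_gt0 // expRK lnA /A.
rewrite !(ln_div, lnM) ?posrE ?mulr_gt0 ?prodr_gt0 ?exprn_gt0 //.
rewrite !ln_prod // lnXn // -[ln tau *+ _]mulr_natl.
(* Signed count of the constants ln (2 pi) / 2: kl cells and one total against k + l margins. The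
   natural subtractions are exact as k, l >= 1. *)
have kl : ((k - 1) * (l - 1))%:R = k%:R * l%:R - k%:R - l%:R + 1 :> R.
  by rewrite natrM !natrB //; ring.
rewrite kl rowE colE cellE totE NIE natrM.
rewrite -/N -/tau in rem_le *.
(* All terms but the remainders cancel, which leaves [rem_le]. *)
by lra.
Qed.
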